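(* Let $A\in\mathbb{R}^{n\times n}$, $B\in\mathbb{R}^{n\times m}$ and $R\in\mathbb{R}^{m\times m}$ with $R\succ\mathbf{0}$. If there exist a matrix $X\in\mathbb{R}^{n\times n}$ with $X\succ\mathbf{0}$ and a matrix $Y\in\mathbb{R}^{n\times n}$ (not necessarily symmetric) satisfying $$XA^T+AX-Y^TBR^{-1}B^T-BR^{-1}B^TY\prec\mathbf{0},$$ then the matrix $A-BR^{-1}B^TP$, where $P=YX^{-1}$, is Hurwitz.
   Context: For a real square matrix $M$, $M\succ\mathbf{0}$ (respectively $M\prec\mathbf{0}$) means that $M$ is symmetric and positive-definite (respectively symmetric and negative-definite). A real square matrix is Hurwitz if all its eigenvalues have strictly negative real parts. *)

(* Defs.v *)
From mathcomp Require Import all_boot all_order all_algebra.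
From mathcomp Require Import reals complex.

Set Implicit Arguments.
Unset Strict Implicit.
Unset Printing Implicit Defensive.

Import Order.TTheory GRing.Theory Num.Theory.

Local Open Scope ring_scope.
Local Open Scope complex_scope.

Definition posdefmx (K : realType) (n : nat) (M : 'M[K]_n) : Prop :=
  M \is symmetricmx /\
  (forall v : 'cV[K]_n, v != 0 -> 0 < (v^T *m M *m v) 0 0).

Definition negdefmx (K : realType) (n : nat) (M : 'M[K]_n) : Prop :=
  M \is symmetricmx /\
  (forall v : 'cV[K]_n, v != 0 -> (v^T *m M *m v) 0 0 < 0).

(* The eigenvalues are the complex ones: M is first mapped to 'M[K[i]]_n.
   [eigenvalue] uses row eigenvectors, which gives the same set of
   eigenvalues as column eigenvectors (eigenvalue_root_char). *)
Definition hurwitz (K : realType) (n : nat) (M : 'M[K]_n) : Prop :=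
  forall z : K[i], eigenvalue (map_mx (real_complex K) M) z -> complex.Re z < 0.

(* Main.v *)
Require Import Defs.
From mathcomp Require Import all_boot all_order all_algebra.
From mathcomp Require Import reals complex.

(** With [S = B *m invmx R *m B^T], which is symmetric because [R] is, the
    closed-loop matrix [M = A - S *m (Y *m invmx X)] satisfies
    [M *m X = A *m X - S *m Y], since a positive definite [X] is invertible.
    The left-hand side of the matrix inequality is therefore exactly
    [M *m X + X *m M^T], and the claim is Lyapunov's criterion for [M] with the
    certificate [X] ([lyapunov_hurwitz]).

    The criterion is proved over the reals.  A complex row eigenvector
    [u + 'i v] of [M] for [a + 'i b] gives [u *m M = a *: u - b *: v] and
    [v *m M = b *: u + a *: v].  When the form of [M *m X + X *m M^T] is summed
    over [u] and [v], the terms in [b] cancel by symmetry of [X], and what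
    remains is [2 a] times the corresponding sum for the form of [X].  The
    former sum is negative and the latter positive, hence [a < 0]. *)

Set Implicit Arguments.
Unset Strict Implicit.
Unset Printing Implicit Defensive.

Import Order.TTheory GRing.Theory Num.Theory.

Local Open Scope ring_scope.

Lemma posdefmx_tr (K : realType) (n : nat) (M : 'M[K]_n) :
  posdefmx M -> M^T = M.
Proof.
case=> /is_hermitianmxP eM _.
by rewrite [in RHS]eM expr0 scale1r; apply/matrixP => i j; rewrite !mxE.
Qed.

Lemma posdefmx_unit (K : realType) (n : nat) (M : 'M[K]_n) :
  posdefmx M -> M \in unitmx.
Proof.
case=> _ Mpos; rewrite -row_free_unit; apply: inj_row_free => v vM0.
apply/eqP; apply: contraT => v0.
by have := Mpos v^T; rewrite trmx_eq0 trmxK vM0 mul0mx mxE ltxx; apply.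
Qed.

(** The real and imaginary parts of a complex eigenvector are not both zero,
    but one of them may be; hence the sum of the two values. *)
Lemma form_pair_gt0 (K : realType) (n : nat) (M : 'M[K]_n) (u v : 'rV[K]_n) :
  (forall w : 'cV[K]_n, w != 0 -> 0 < (w^T *m M *m w) 0 0) ->
  (u != 0) || (v != 0) ->
  0 < (u *m M *m u^T) 0 0 + (v *m M *m v^T) 0 0.
Proof.
move=> Mpos uv0.
have gt0 (w : 'rV_n) : w != 0 -> 0 < (w *m M *m w^T) 0 0.
  by move=> w0; have := Mpos w^T; rewrite trmxK trmx_eq0; apply.
have ge0 (w : 'rV_n) : 0 <= (w *m M *m w^T) 0 0.
  by have [->|/gt0/ltW//] := eqVneq w 0; rewrite !mul0mx mxE.
by case/orP: uv0 => /gt0 ?; [apply: ltr_pwDl | apply: ltr_wpDl].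
Qed.

Lemma real_eigen_parts (K : realType) (n : nat) (M : 'M[K]_n)
    (z : complex K) (w : 'rV[complex K]_n)
    (u := map_mx (@complex.Re K) w) (v := map_mx (@complex.Im K) w) :
  w *m map_mx (real_complex K) M = z *: w ->
  u *m M = complex.Re z *: u - complex.Im z *: v /\
  v *m M = complex.Im z *: u + complex.Re z *: v.
Proof.
move=> ewM.
have ent j : \sum_i w 0 i * real_complex K (M i j) = z * w 0 j.
  by have /rowP/(_ j) := ewM; rewrite !mxE => <-; apply: eq_bigr => i _; rewrite mxE.
have ReD : {morph @complex.Re K : x y / x + y} by case=> ? ? [].
have ImD : {morph @complex.Im K : x y / x + y} by case=> ? ? [].
have Re0 : complex.Re (0 : complex K) = 0 by [].
have Im0 : complex.Im (0 : complex K) = 0 by [].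
split; apply/rowP => j; rewrite !mxE.
  have := congr1 (@complex.Re K) (ent j); rewrite (big_morph _ ReD Re0).
  case: z (w 0 j) {ewM ent} => a b [c d] /= <-.
  apply: eq_bigr => i _; rewrite !mxE.
  by case: (w 0 i) => x y /=; rewrite mulr0 subr0.
have := congr1 (@complex.Im K) (ent j); rewrite (big_morph _ ImD Im0).
case: z (w 0 j) {ewM ent} => a b [c d] /= e.
rewrite [b * c + _]addrC -e; apply: eq_bigr => i _; rewrite !mxE.
by case: (w 0 i) => x y /=; rewrite mulr0 add0r.
Qed.

(** Lyapunov's criterion, by evaluating both forms on the real and imaginary
    parts of an eigenvector. *)
Lemma lyapunov_hurwitz (K : realType) (n : nat) (M X : 'M[K]_n) :
  posdefmx X -> negdefmx (M *m X + X *m M^T) -> hurwitz M.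
Proof.
move=> Xpd [_ Qneg] z /eigenvalueP[w ewM w0].
have [eu ev] := real_eigen_parts ewM.
set u := map_mx _ w in eu ev *; set v := map_mx (@complex.Im K) w in eu ev *.
have uv0 : (u != 0) || (v != 0).
  apply: contraNT w0; rewrite negb_or !negbK => /andP[/eqP u0 /eqP v0].
  apply/eqP/rowP => j; apply/eqP; rewrite eq_complex.
  by have /rowP/(_ j) := u0; have /rowP/(_ j) := v0; rewrite !mxE => -> ->; rewrite !eqxx.
have trE (x : 'M[K]_1) : x 0 0 = x^T 0 0 by rewrite mxE.
have Xuv : (v *m X *m u^T) 0 0 = (u *m X *m v^T) 0 0.
  by rewrite trE !trmx_mul trmxK (posdefmx_tr Xpd) mulmxA.
have QE (x : 'rV_n) :
      (x *m (M *m X + X *m M^T) *m x^T) 0 0 = (x *m M *m X *m x^T) 0 0 *+ 2.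
  rewrite mulmxDr mulmxDl [LHS]mxE mulr2n mulmxA; congr (_ + _).
  by rewrite trE !trmx_mul !trmxK (posdefmx_tr Xpd) !mulmxA.
have Xgt0 := form_pair_gt0 Xpd.2 uv0.
have Qlt0 : (u *m M *m X *m u^T) 0 0 + (v *m M *m X *m v^T) 0 0 < 0.
  have Npos (x : 'cV[K]_n) :
      x != 0 -> 0 < (x^T *m - (M *m X + X *m M^T) *m x) 0 0.
    by move=> /Qneg; rewrite mulmxN mulNmx [X in _ -> 0 < X]mxE oppr_gt0.
  have := form_pair_gt0 Npos uv0; rewrite !mulmxN !mulNmx.
  rewrite ![(- _ : 'M_1) 0 0]mxE -opprD oppr_gt0 !QE -mulrnDl.
  by rewrite pmulrn_llt0.
rewrite -(pmulr_llt0 _ Xgt0); move: Qlt0; rewrite eu ev.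
rewrite !(mulmxDl, mulNmx) -!scalemxAl ![(_ + _ : 'M_1) 0 0]mxE.
rewrite [(- _ : 'M_1) 0 0]mxE ![(_ *: _ : 'M_1) 0 0]mxE Xuv.
by rewrite addrA subrK mulrDr.
Qed.

Theorem proposition2 (K : realType) (n m : nat)
    (A : 'M[K]_n) (B : 'M[K]_(n, m)) (R : 'M[K]_m) (hR : posdefmx R)
    (X Y : 'M[K]_n) (hX : posdefmx X)
    (hXY : negdefmx (X *m A^T + A *m X
                     - Y^T *m B *m invmx R *m B^T
                     - B *m invmx R *m B^T *m Y)) :
  let P := Y *m invmx X in
  hurwitz (A - B *m invmx R *m B^T *m P).
Proof.
move=> P; apply: (lyapunov_hurwitz hX).
set M := A - _.
have MX : M *m X = A *m X - B *m invmx R *m B^T *m Y.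
  by rewrite mulmxBl -!mulmxA mulVmx ?mulmx1 ?posdefmx_unit.
have XM : X *m M^T = X *m A^T - Y^T *m B *m invmx R *m B^T.
  rewrite -{1}(posdefmx_tr hX) -trmx_mul MX linearB /= !trmx_mul trmxK.
  by rewrite trmx_inv (posdefmx_tr hR) (posdefmx_tr hX) !mulmxA.
rewrite MX XM addrC.
suff -> : X *m A^T - Y^T *m B *m invmx R *m B^T
          + (A *m X - B *m invmx R *m B^T *m Y)
        = X *m A^T + A *m X - Y^T *m B *m invmx R *m B^T
          - B *m invmx R *m B^T *m Y by [].
by rewrite addrA; congr (_ - _); rewrite addrAC.
Qed.
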